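(* Let $\psi\colon[0,\infty)\to\mathbb{R}$ and define $g(s)=\psi\left(\operatorname{arcosh}\frac{s}{2}\right)$ for $s\geq2$. Assume that there exists a convex and non-decreasing function $\bar g\colon[0,\infty)\to\mathbb{R}$ such that $\bar g=g$ on $[2,\infty)$. Let $W_\psi(F)=\sum_{i=1}^3\psi\left(|\log\lambda_i|\right)$ for $F\in\mathrm{SL}(3)$, where $\lambda_1,\lambda_2,\lambda_3$ are the singular values of $F$. Let $F_t=F+t\,a\otimes b$ with $F\in\mathrm{SL}(3)$, $a,b\in\mathbb{R}^3$, and $\langle b,F^{-1}a\rangle=0$. Then $t\mapsto W_\psi(F_t)$ is convex over the unit interval $[0,1]$.
   Context: $\mathrm{SL}(3)$ is the set of real $3\times3$ matrices with determinant $1$. Singular values are counted with multiplicity. $a\otimes b=ab^T$, $\langle\cdot,\cdot\rangle$ is the Euclidean inner product on $\mathbb{R}^3$, and $\operatorname{arcosh}\colon[1,\infty)\to[0,\infty)$ is the inverse of $\cosh$ on $[0,\infty)$. For $F\in\mathrm{SL}(3)$, one has $\det(F+t\,a\otimes b)=1+t\,\langle b,F^{-1}a\rangle$, so the condition $\langle b,F^{-1}a\rangle=0$ means that $F_t\in\mathrm{SL}(3)$ for every $t$. *)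

(* Defs.v *)
From HB Require Import structures.
From mathcomp Require Import all_boot all_order all_algebra.
From mathcomp Require Import polyrcf.
From mathcomp Require Import all_classical all_reals all_analysis.

Set Implicit Arguments.
Unset Strict Implicit.
Unset Printing Implicit Defensive.

Import Order.TTheory GRing.Theory Num.Theory.
Import numFieldNormedType.Exports.

Local Open Scope classical_set_scope.
Local Open Scope ring_scope.

Definition cosh (R : realType) (x : R) : R := (expR x + expR (- x)) / 2.

(* The partial inverse of cosh restricted to [0, +oo[; only its values on
   [1, +oo[, the image of that restriction, are meaningful. *)
Definition arcosh (R : realType) : R -> R :=
  'pinv_(fun=> 0) `[0, +oo[ (@cosh R).

Definition dotv (R : realType) (n : nat) (u v : 'cV[R]_n) : R :=
  \sum_(i < n) u i 0 * v i 0.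

Definition tensor (R : realType) (n : nat) (a b : 'cV[R]_n) : 'M[R]_n :=
  a *m b^T.

(* Square roots of the eigenvalues of F^T F, each repeated according to its
   algebraic multiplicity. rootsR lists each real root once and mup is its
   multiplicity; as F^T F is symmetric positive semidefinite, all n eigenvalues
   are real and nonnegative, so the list has length n. *)
Definition singular_values (R : realType) (n : nat) (F : 'M[R]_n) : seq R :=
  let p := char_poly (F^T *m F) in
  flatten [seq nseq (mup x p) (Num.sqrt x) | x <- rootsR p].

(* Only meant for F of determinant 1, where every singular value is positive. *)
Definition W (R : realType) (psi : R -> R) (F : 'M[R]_3) : R :=
  \sum_(l <- singular_values F) psi `|ln l|.

(* Main.v *)
(* F + F^-T has the singular vectors of F and singular values l + 1/l, where l
   runs over those of F, and l + 1/l = 2 cosh |log l|. Hence W_psi(F) is the sum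
   of gbar over the singular values of F + F^-T. Along the given line F_t^-1,
   like F_t, is affine in t (Sherman-Morrison), so it remains to prove that
   G |-> sum_i gbar (sigma_i G) is convex on all matrices. If
   G = t G0 + (1 - t) G1 has the singular vectors u_i, v_i, then
   sigma_i G = t <u_i, G0 v_i> + (1 - t) <u_i, G1 v_i>, and
   |<u_i, G0 v_i>| <= sum_j w_ij sigma_j G0 for a doubly stochastic matrix w;
   monotonicity and Jensen's inequality conclude. *)
Require Import Defs.
From HB Require Import structures.
From mathcomp Require Import all_boot all_order all_algebra.
From mathcomp Require Import complex polyrcf ring lra.
From mathcomp Require Import all_classical all_reals all_analysis.

Set Implicit Arguments.
Unset Strict Implicit.
Unset Printing Implicit Defensive.

Import Order.TTheory GRing.Theory Num.Theory.
Import numFieldNormedType.Exports.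

Local Open Scope classical_set_scope.
Local Open Scope ring_scope.

(** * Orthogonal matrices *)

Definition orthogonal_mx (R : nzRingType) n (Q : 'M[R]_n) : Prop :=
  Q^T *m Q = 1%:M.

Lemma orthogonal_mx1 (R : nzRingType) n : orthogonal_mx (1%:M : 'M[R]_n).
Proof. by rewrite /orthogonal_mx trmx1 mul1mx. Qed.

Section OrthogonalMatrix.
Variables (R : comUnitRingType) (n : nat).
Implicit Types P Q : 'M[R]_n.

Lemma orthogonal_mx_tr Q : orthogonal_mx Q -> orthogonal_mx Q^T.
Proof. by rewrite /orthogonal_mx trmxK; exact: mulmx1C. Qed.

Lemma orthogonal_mxM P Q :
  orthogonal_mx P -> orthogonal_mx Q -> orthogonal_mx (P *m Q).
Proof.
rewrite /orthogonal_mx => oP oQ.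
by rewrite trmx_mul mulmxA -(mulmxA Q^T) oP mulmx1.
Qed.

Lemma orthogonal_mx_unit Q : orthogonal_mx Q -> Q \in unitmx.
Proof. by case/mulmx1_unit. Qed.

Lemma orthogonal_mx_inv Q : orthogonal_mx Q -> invmx Q = Q^T.
Proof.
move=> oQ; have uQ := orthogonal_mx_unit oQ.
by rewrite -[LHS]mul1mx -oQ mulmxK.
Qed.

Lemma orthogonal_mx_row Q i : orthogonal_mx Q -> \sum_j Q i j ^+ 2 = 1.
Proof.
move=> /mulmx1C /matrixP /(_ i i); rewrite !mxE eqxx mulr1n => <-.
by apply: eq_bigr => j _; rewrite mxE expr2.
Qed.

Lemma orthogonal_mx_col Q j : orthogonal_mx Q -> \sum_i Q i j ^+ 2 = 1.
Proof.
move=> /orthogonal_mx_tr /(orthogonal_mx_row j) <-.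
by apply: eq_bigr => i _; rewrite mxE.
Qed.

End OrthogonalMatrix.

(** * Spectral theorem for real symmetric matrices *)

(** Over the complex extension the matrix is Hermitian, so its spectral diagonal is real. An entry
    of that diagonal is thus an eigenvalue lying in the image of [R], and being an eigenvalue
    descends along the field extension. *)
Lemma symmetric_mx_eigenvalue (R : rcfType) n (A : 'M[R]_n.+1) :
  A^T = A -> exists l, eigenvalue A l.
Proof.
move=> symA; pose Ac := map_mx (real_complex R) A.
have hermA : Ac \is hermsymmx.
  apply/is_hermitianmxP; rewrite expr0 scale1r.
  apply/matrixP => i j; rewrite !mxE -[in LHS]symA mxE.
  by apply/esym/CrealP/complex_realP; exists (A j i).
have /orthomx_spectralP := hermitian_normalmx hermA.
have /mxOverP/(_ 0 0) := hermitian_spectral_diag_real hermA.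
set P := spectralmx Ac; set d := spectral_diag Ac => d_real AcE.
have uP : P \in unitmx := spectral_unit Ac.
have : eigenvalue Ac (d 0 0).
  apply/eigenvalueP; exists (row 0 P).
    rewrite {1}AcE !mulmxA -row_mul mulmxV// row1 -rowE row_diag_mx.
    by rewrite -scalemxAl -rowE.
  apply: contraTneq uP => P0; rewrite unitmxE unitfE.
  rewrite (expand_det_row _ 0) big1 ?eqxx// => j _.
  by move/rowP/(_ j): P0; rewrite !mxE => ->; rewrite mul0r.
have /complex_realP[l ->] := d_real.
by rewrite eigenvalue_map; exists l.
Qed.

(** The reflection [1 - 2 w w^T / (w^T w)] with [w = v - e] exchanges the unit vectors [e] and
    [v]. *)
Lemma householder_reflection (R : rcfType) n (v : 'cV[R]_n.+1) :
  v^T *m v = 1%:M ->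
  exists2 H : 'M[R]_n.+1, orthogonal_mx H & H *m delta_mx 0 0 = v.
Proof.
move=> v1; set e := delta_mx 0 0 : 'cV[R]_n.+1.
(* For [v = e] the vector [w] vanishes and defines no reflection. *)
have [->|ve] := eqVneq v e.
  by exists 1%:M; rewrite ?mul1mx//; exact: orthogonal_mx1.
pose w := v - e; pose c := (w^T *m w) 0 0.
have cE : w^T *m w = c%:M by rewrite [LHS]mx11_scalar.
have c0 : c != 0.
  apply: contra ve => /eqP; rewrite /c mxE => /eqP.
  rewrite psumr_eq0; last by move=> i _; rewrite mxE -expr2 sqr_ge0.
  move=> /allP w0; apply/eqP/colP => i.
  have /= := w0 i (mem_index_enum i).
  by rewrite mxE mulf_eq0 orbb !mxE subr_eq0 => /eqP.
have eE : e^T *m e = 1%:M.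
  by rewrite trmx_delta mul_delta_mx; apply/matrixP => i j; rewrite !ord1 !mxE.
have vec : (v^T *m e) = (e^T *m v).
  by rewrite [LHS]mx11_scalar -tr_scalar_mx -mx11_scalar trmx_mul trmxK.
(* As [v] and [e] have equal length, [|w|^2 = 2 - 2 <v, e> = - 2 <w, e>]. *)
have wE : w^T *m e = - (c / 2)%:M.
  have : w^T *m w = - (w^T *m e) *+ 2.
    rewrite /w !(mulmxBr, raddfB)/= !mulmxBl v1 eE -vec mulr2n.
    by rewrite !opprB addrC addrAC -!addrA addrC.
  rewrite cE; move: (w^T *m e) => q; rewrite [q]mx11_scalar.
  move=> /matrixP/(_ 0 0); rewrite !mxE !mulr1n => cq.
  by rewrite -raddfN; congr (_%:M); lra.
pose M := (2 / c) *: (w *m w^T); pose H := 1%:M - M.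
have symH : H^T = H by rewrite /H /M linearB linearZ/= trmx1 trmx_mul trmxK.
(* [M] is twice the orthogonal projection onto the line of [w]. *)
have MM : M *m M = M + M.
  rewrite /M -scalemxAl -scalemxAr mulmxA -(mulmxA w) cE mul_mx_scalar.
  rewrite -scalemxAl !scalerA -scalerDl; congr (_ *: _).
  by field.
exists H.
  rewrite /orthogonal_mx symH mulmxBl mul1mx mulmxBr mulmx1 MM.
  by rewrite opprB addrK subrK.
rewrite /H /M mulmxBl mul1mx -scalemxAl -mulmxA wE mulmxN mul_mx_scalar.
rewrite scalerN scalerA opprK.
have -> : 2 / c * (c / 2) = 1 by field.
by rewrite scale1r /w addrC subrK.
Qed.

(** Deflation: after conjugation by an orthogonal matrix sending the first basis vector to a unit
    eigenvector, a symmetric block of size [n] remains. *)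
Lemma symmetric_mx_diagonalizable (R : rcfType) n (A : 'M[R]_n) :
  A^T = A ->
  exists Q d, orthogonal_mx Q /\ Q^T *m A *m Q = diag_mx d.
Proof.
elim: n A => [|n IHn] A symA.
  exists 1%:M, 0; split; first exact: orthogonal_mx1.
  by apply/matrixP => -[].
have [l /eigenvalueP[u uA u0]] := symmetric_mx_eigenvalue symA.
pose c := (u *m u^T) 0 0.
have c_gt0 : 0 < c.
  have c_ge0 : 0 <= c.
    by rewrite /c mxE sumr_ge0// => i _; rewrite mxE -expr2 sqr_ge0.
  rewrite lt_def c_ge0 andbT; apply: contra u0 => /eqP; rewrite /c mxE => /eqP.
  rewrite psumr_eq0; last by move=> i _; rewrite mxE -expr2 sqr_ge0.
  move=> /allP w0; apply/eqP/rowP => i.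
  have /= := w0 i (mem_index_enum i).
  by rewrite !mxE mulf_eq0 orbb => /eqP.
(* [eigenvalueP] yields a row eigenvector; by symmetry of [A] its transpose is a column eigenvector,
   here normalised. *)
pose v := (Num.sqrt c)^-1 *: u^T.
have Av : A *m v = l *: v.
  by rewrite -scalemxAr -{1}symA -trmx_mul uA linearZ/= !scalerA mulrC.
have vv : v^T *m v = 1%:M.
  have -> : v^T = (Num.sqrt c)^-1 *: u by rewrite /v linearZ/= trmxK.
  rewrite /v -scalemxAr -scalemxAl [u *m _]mx11_scalar -/c.
  rewrite scalerA -invfM -expr2 sqr_sqrtr ?ltW// scale_scalar_mx mulVf//.
  by rewrite gt_eqF.
have [H oH He] := householder_reflection vv.
pose B : 'M[R]_(1 + n) := H^T *m A *m H.
have symB : B^T = B by rewrite /B !trmx_mul trmxK symA mulmxA.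
have Be : B *m delta_mx 0 0 = l *: (delta_mx 0 0 : 'cV[R]_(1 + n)).
  by rewrite -!mulmxA He Av -scalemxAr -He mulmxA oH mul1mx.
have Bi0 i j : B i (lshift n j) = l * (i == lshift n j)%:R.
  have -> : lshift n j = 0 by apply: val_inj; rewrite /= ord1.
  have := congr1 (fun M : 'cV[R]_(1 + n) => M i 0) Be.
  by rewrite -colE !mxE andbT.
have Bul : ulsubmx B = l%:M.
  by apply/matrixP => i j; rewrite [LHS]mxE [LHS]mxE Bi0 !mxE !ord1 eqxx mulr1.
have Bdl : dlsubmx B = 0.
  by apply/matrixP => i j; rewrite [LHS]mxE [LHS]mxE Bi0 mxE eq_rlshift mulr0.
(* Symmetry carries the zeros of the first column over to the first row. *)
have Bur : ursubmx B = 0 by rewrite -[LHS]trmxK trmx_ursub symB Bdl trmx0.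
have symC : (drsubmx B)^T = drsubmx B by rewrite trmx_drsub symB.
have [Q [d [oQ Qd]]] := IHn _ symC.
pose Q1 : 'M[R]_(1 + n) := block_mx 1%:M 0 0 Q.
have oQ1 : orthogonal_mx Q1.
  rewrite /orthogonal_mx tr_block_mx !trmx0 trmx1 mulmx_block oQ.
  by rewrite !(mulmx0, mul0mx, mulmx1, addr0, add0r) -scalar_mx_block.
have Q1B : Q1^T *m B *m Q1 = diag_mx (row_mx (l%:M : 'rV[R]_1) d).
  rewrite -[B]submxK Bul Bdl Bur tr_block_mx !trmx0 trmx1 !mulmx_block.
  rewrite !(mulmx0, mul0mx, mulmx1, mul1mx, addr0, add0r) Qd diag_mx_row.
  by congr block_mx; apply/matrixP => i j; rewrite !mxE !ord1 !mulr1n.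
exists (H *m Q1), (row_mx l%:M d); split; first exact: orthogonal_mxM.
by rewrite trmx_mul -[RHS]Q1B /B !mulmxA.
Qed.

(** * Singular value decomposition *)

(** With [F^T F = Q d Q^T], take [s = sqrt d], [V = Q] and [U = F Q s^-1]; invertibility of [F]
    makes every [d_i] positive, so the division is legitimate. *)
Lemma invertible_mx_svd (R : rcfType) n (F : 'M[R]_n) :
  F \in unitmx ->
  exists (U V : 'M[R]_n) (s : 'rV[R]_n), [/\ orthogonal_mx U, orthogonal_mx V,
    forall i, 0 < s 0 i & F = U *m diag_mx s *m V^T].
Proof.
move=> uF.
have [|Q [d [oQ Qd]]] := @symmetric_mx_diagonalizable _ _ (F^T *m F).
  by rewrite trmx_mul trmxK.
have d_gt0 i : 0 < d 0 i.
  (* [d_i] is the squared length of column [i] of [F Q], and an invertible matrix has no zero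
     column. *)
  have dE : d 0 i = \sum_k (F *m Q) k i ^+ 2.
    transitivity (((F *m Q)^T *m (F *m Q)) i i).
      by rewrite trmx_mul mulmxA -(mulmxA Q^T) Qd mxE eqxx mulr1n.
    by rewrite mxE; apply: eq_bigr => k _; rewrite mxE expr2.
  rewrite lt_def dE sumr_ge0 ?andbT => [|k _]; last exact: sqr_ge0.
  have : F *m Q \in unitmx by rewrite unitmx_mul uF orthogonal_mx_unit.
  apply: contraTneq => /eqP; rewrite psumr_eq0 => [|k _]; last exact: sqr_ge0.
  move=> /allP FQ0; rewrite unitmxE unitfE (expand_det_col _ i) big1 ?eqxx//.
  move=> k _; have := FQ0 k (mem_index_enum k).
  by rewrite sqrf_eq0 => /eqP ->; rewrite mul0r.
pose s := \row_i Num.sqrt (d 0 i); pose r := \row_i (s 0 i)^-1.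
have s_gt0 i : 0 < s 0 i by rewrite mxE sqrtr_gt0.
have rs : diag_mx r *m diag_mx s = 1%:M.
  rewrite mulmx_diag; apply/matrixP => i j; rewrite !mxE.
  by rewrite mulVf// gt_eqF// sqrtr_gt0.
(* With [d = Q^T F^T F Q], this is the orthogonality of [U = F Q r]. *)
have rdr : diag_mx r *m diag_mx d *m diag_mx r = 1%:M.
  rewrite !mulmx_diag; apply/matrixP => i j; rewrite !mxE; congr (_ *+ _).
  by rewrite mulrAC -invfM -expr2 sqr_sqrtr ?ltW// mulVf// gt_eqF.
exists (F *m Q *m diag_mx r), Q, s; split => //.
  by rewrite /orthogonal_mx -[RHS]rdr -Qd !trmx_mul tr_diag_mx !mulmxA.
rewrite -(mulmxA _ (diag_mx r)) rs mulmx1 -mulmxA -orthogonal_mx_inv//.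
by rewrite mulmxV ?mulmx1// orthogonal_mx_unit.
Qed.

(** The multiplicity of a root is its number of occurrences in [r], and [rootsR p] is duplicate-free
    with the same members as [undup r]. *)
Lemma perm_rootsR_prod_XsubC (R : rcfType) (r : seq R) (p : {poly R}) :
  p = \prod_(x <- r) ('X - x%:P) ->
  perm_eq (flatten [seq nseq (mup x p) x | x <- rootsR p]) r.
Proof.
move=> pE; rewrite -(permPr (perm_count_undup r)).
have p0 : p != 0 by rewrite pE monic_neq0// monic_prod_XsubC.
have mupE x : mup x p = count_mem x r by rewrite pE mu_prod_XsubC.
under eq_map do rewrite mupE.
apply/perm_flatten/perm_map/uniq_perm; rewrite ?undup_uniq ?uniq_roots//.
move=> x; rewrite mem_undup -(root_prod_XsubC r) -pE.
by rewrite -roots_on_rootsR// in_itv.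
Qed.

Lemma char_poly_orthogonal_conj (R : comUnitRingType) n (V A : 'M[R]_n) :
  orthogonal_mx V -> char_poly (V *m A *m V^T) = char_poly A.
Proof.
move=> /mulmx1C VV; rewrite /char_poly /char_poly_mx.
set f := map_mx polyC; pose Vp := f V.
have VpV : Vp *m f V^T = 1%:M by rewrite -map_mxM VV map_mx1.
have -> : 'X%:M - f (V *m A *m V^T) = Vp *m ('X%:M - f A) *m f V^T.
  rewrite mulmxBr mulmxBl mul_mx_scalar -scalemxAl VpV scalemx1.
  by rewrite /f !map_mxM.
by rewrite !det_mulmx mulrAC -det_mulmx VpV det1 mul1r.
Qed.

(** [F^T F = V diag(s^2) V^T] has a characteristic polynomial that splits with roots [s_i^2];
    nonnegativity recovers [s_i] as their square roots. *)
Lemma singular_values_svd (R : realType) n (U V : 'M[R]_n) (s : 'rV[R]_n) :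
  orthogonal_mx U -> orthogonal_mx V -> (forall i, 0 <= s 0 i) ->
  perm_eq (singular_values (U *m diag_mx s *m V^T))
          [seq s 0 i | i <- enum 'I_n].
Proof.
move=> oU oV s_ge0; rewrite /singular_values; set p := char_poly _.
have pE : p = \prod_(x <- [seq s 0 i ^+ 2 | i <- enum 'I_n]) ('X - x%:P).
  have -> : p = char_poly (diag_mx (\row_i s 0 i ^+ 2)).
    rewrite -(char_poly_orthogonal_conj _ oV); congr char_poly.
    have -> : diag_mx (\row_i s 0 i ^+ 2) = diag_mx s *m diag_mx s.
      by rewrite mulmx_diag; congr diag_mx; apply/rowP => i; rewrite !mxE expr2.
    rewrite !trmx_mul trmxK tr_diag_mx !mulmxA.
    by rewrite -(mulmxA _ U^T U) oU mulmx1.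
  rewrite char_poly_trig ?diag_mx_is_trig// big_map big_enum /=.
  by apply: eq_bigr => i _; rewrite !mxE eqxx.
have -> : [seq s 0 i | i <- enum 'I_n] =
    [seq Num.sqrt x | x <- [seq s 0 i ^+ 2 | i <- enum 'I_n]].
  rewrite -[RHS]map_comp; apply: eq_map => i /=.
  by rewrite sqrtr_sqr ger0_norm.
have -> : [seq nseq (mup x p) (Num.sqrt x) | x <- rootsR p] =
    [seq [seq Num.sqrt y | y <- nseq (mup x p) x] | x <- rootsR p].
  by apply: eq_map => x; rewrite map_nseq.
by rewrite map_comp -map_flatten perm_map// perm_rootsR_prod_XsubC.
Qed.

(** * Hyperbolic cosine and its inverse *)

(** With [a = e^x] and [b = e^y], clearing denominators gives [(a - b)(a b - 1) = 0]; since
    [a, b >= 1], the case [a b = 1] forces [a = b = 1]. *)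
Lemma cosh_inj (R : realType) : {in [set` `[0, +oo[] &, injective (@cosh R)}.
Proof.
move=> x y; rewrite !inE/= !in_itv/= !andbT => x0 y0 xy.
have a1 : 1 <= expR x by rewrite -expR0 ler_expR.
have b1 : 1 <= expR y by rewrite -expR0 ler_expR.
apply: expR_inj; move: xy; rewrite /cosh !expRN.
move: (expR x) (expR y) a1 b1 => a b a1 b1.
have [a0 b0] : a != 0 /\ b != 0 by split; lra.
move=> /(congr1 (fun z => z * (2 * a * b))).
have -> : (a + a^-1) / 2 * (2 * a * b) = (a * a + 1) * b by field.
have -> : (b + b^-1) / 2 * (2 * a * b) = (b * b + 1) * a by field.
move=> ab; have /eqP : (a - b) * (a * b - 1) = 0.
  by transitivity ((a * a + 1) * b - (b * b + 1) * a); [ring|rewrite ab subrr].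
by rewrite mulf_eq0 !subr_eq0 => /orP[] /eqP // ab1; nra.
Qed.

Lemma arcoshK (R : realType) (x : R) : 0 <= x -> arcosh (cosh x) = x.
Proof.
move=> x0; rewrite /arcosh.
by apply: pinvKV; [exact: cosh_inj|rewrite inE/= in_itv/= x0].
Qed.

Lemma cosh_norm_ln (R : realType) (s : R) :
  0 < s -> cosh `|ln s| = (s + s^-1) / 2.
Proof.
move=> s0; rewrite /cosh; have [_|_] := ger0P (ln s).
  by rewrite expRN lnK.
by rewrite opprK expRN lnK// addrC.
Qed.

(** * Jensen's inequality and convex sums over singular values *)

(** Induction on the number of points. Membership of the barycentre in [A] is carried along because
    the two-point inequality requires it of the normalised tail. *)
Lemma convex_function_sum (R : realFieldType) (E : lmodType R)
    (A : set (convex_lmodType E)) (f : convex_lmodType E -> R^o) :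
  convex_set A -> convex_function A f ->
  forall n (p : 'I_n -> R) (x : 'I_n -> E),
  (forall i, 0 <= p i) -> \sum_i p i = 1 -> (forall i, x i \in A) ->
  \sum_i p i *: x i \in A /\ f (\sum_i p i *: x i) <= \sum_i p i * f (x i).
Proof.
move=> cA cf; elim=> [|n IHn] p x p0 p1 xA.
  by move: p1; rewrite big_ord0 => /eqP; rewrite eq_sym oner_eq0.
rewrite !big_ord_recl; move: p1; rewrite big_ord_recl => p1.
have q0 : 0 <= \sum_i p (lift ord0 i) by exact: sumr_ge0.
(* Normalising the tail divides by [1 - p ord0], so weight one is treated apart. *)
have [p01|p01] := eqVneq (p ord0) 1.
  have pl0 i : p (lift ord0 i) = 0.
    have /eqP : \sum_i p (lift ord0 i) = 0 by lra.
    by rewrite psumr_eq0// => /allP/(_ i (mem_index_enum i))/eqP.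
  rewrite p01 scale1r mul1r !big1 ?addr0// => i _; first by rewrite pl0 mul0r.
  by rewrite pl0 scale0r.
have p0_le1 : p ord0 <= 1 by lra.
pose t : {i01 R} := Itv01 (p0 ord0) p0_le1.
have r0 : 0 < 1 - p ord0 by rewrite subr_gt0 lt_def eq_sym p01.
pose q i := p (lift ord0 i) / (1 - p ord0).
have qE i : p (lift ord0 i) = (1 - p ord0) * q i.
  by rewrite /q mulrC divfK// gt_eqF.
have [||yA fy] := IHn q (fun i => x (lift ord0 i)) _ _ (fun i => xA _).
- by move=> i; rewrite divr_ge0// ltW.
- by rewrite /q -mulr_suml -p1 addrAC subrr add0r divff//; lra.
set y := \sum_i _ in yA fy.
have -> : \sum_i p (lift ord0 i) *: x (lift ord0 i) = (1 - p ord0) *: y.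
  by rewrite scaler_sumr; apply: eq_bigr => i _; rewrite scalerA qE.
have -> : \sum_i p (lift ord0 i) * f (x (lift ord0 i)) =
    (1 - p ord0) * \sum_i q i * f (x (lift ord0 i)).
  by rewrite mulr_sumr; apply: eq_bigr => i _; rewrite mulrA qE.
split; first exact: (cA _ _ t (xA ord0) yA).
apply: le_trans (cf t _ _ (xA ord0) yA) _.
by rewrite lerD2l ler_wpM2l// ltW.
Qed.

Section ConvexSumOfSingularValues.
Variables (R : realType) (h : R -> R).
Hypothesis h_convex : @convex_function R R^o [set` `[0, +oo[] h.
Hypothesis h_homo : {in `[0, +oo[ &, {homo h : x y / x <= y}}.

(** Meant for [P = U^T U0] and [Q = V0^T V], where the diagonal entries are the numbers
    [<u_i, G0 v_i>]. *)
Lemma sum_abs_diag_orthogonal n (P Q : 'M[R]_n) (s : 'rV[R]_n) :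
  orthogonal_mx P -> orthogonal_mx Q -> (forall i, 0 <= s 0 i) ->
  \sum_i h `|(P *m diag_mx s *m Q) i i| <= \sum_i h (s 0 i).
Proof.
move=> oP oQ s0.
have A_convex : @convex_set R R^o [set` `[0, +oo[].
  move=> x y t; rewrite !inE/= !in_itv/= !andbT => x0 y0.
  by rewrite addr_ge0// mulr_ge0// subr_ge0.
(* Doubly stochastic; |P_ij Q_ji| <= w_ij by AM-GM. *)
pose w i j := (P i j ^+ 2 + Q j i ^+ 2) / 2.
have w0 i j : 0 <= w i j by rewrite divr_ge0// addr_ge0// sqr_ge0.
have w_row i : \sum_j w i j = 1.
  rewrite -mulr_suml big_split/= orthogonal_mx_row// orthogonal_mx_col//.
  by field.
have w_col j : \sum_i w i j = 1.
  rewrite -mulr_suml big_split/= orthogonal_mx_row// orthogonal_mx_col//.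
  by field.
have bound i : `|(P *m diag_mx s *m Q) i i| <= \sum_j w i j * s 0 j.
  rewrite mxE; apply: le_trans (ler_norm_sum _ _ _) _; apply: ler_sum => j _.
  rewrite mul_mx_diag mxE mulrAC normrM (ger0_norm (s0 j)) ler_wpM2r//.
  have := sqr_ge0 (P i j - Q j i); have := sqr_ge0 (P i j + Q j i).
  by rewrite ler_norml /w !expr2 => ? ?; apply/andP; split; lra.
have ws0 i : 0 <= \sum_j w i j * s 0 j.
  by apply: sumr_ge0 => j _; exact: mulr_ge0.
(* Unit row sums allow Jensen's inequality for each [i]; unit column sums remove the weights once
   the sums are exchanged. *)
apply: (@le_trans _ _ (\sum_i \sum_j w i j * h (s 0 j))).
  apply: ler_sum => i _; apply: (@le_trans _ _ (h (\sum_j w i j * s 0 j))).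
    by apply: h_homo; rewrite ?in_itv/= ?normr_ge0 ?ws0.
  have sA j : s 0 j \in ([set` `[0, +oo[] : set R) by rewrite inE/= in_itv/= s0.
  exact: (convex_function_sum A_convex h_convex (w0 i) (w_row i) sA).2.
rewrite exchange_big/=; apply: ler_sum => j _.
by rewrite -mulr_suml w_col mul1r.
Qed.

(** Stating convexity through explicit decompositions lets the values [s + 1/s] be supplied
    directly, in whatever order they come. *)
Lemma sum_singular_values_convex n (t : {i01 R})
    (U V U0 V0 U1 V1 : 'M[R]_n) (s s0 s1 : 'rV[R]_n) :
  orthogonal_mx U -> orthogonal_mx V ->
  orthogonal_mx U0 -> orthogonal_mx V0 ->
  orthogonal_mx U1 -> orthogonal_mx V1 ->
  (forall i, 0 <= s 0 i) ->
  (forall i, 0 <= s0 0 i) -> (forall i, 0 <= s1 0 i) ->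
  U *m diag_mx s *m V^T = t%:num *: (U0 *m diag_mx s0 *m V0^T) +
                          (1 - t%:num) *: (U1 *m diag_mx s1 *m V1^T) ->
  \sum_i h (s 0 i) <=
    t%:num * \sum_i h (s0 0 i) + (1 - t%:num) * \sum_i h (s1 0 i).
Proof.
move=> oU oV oU0 oV0 oU1 oV1 s_ge0 s0_ge0 s1_ge0 UsV.
pose x i := ((U^T *m U0) *m diag_mx s0 *m (V0^T *m V)) i i.
pose y i := ((U^T *m U1) *m diag_mx s1 *m (V1^T *m V)) i i.
have sE i : s 0 i = t%:num * x i + (1 - t%:num) * y i.
  have : diag_mx s = U^T *m (U *m diag_mx s *m V^T) *m V.
    by rewrite !mulmxA oU mul1mx -mulmxA oV mulmx1.
  rewrite UsV => /matrixP/(_ i i); rewrite mxE eqxx mulr1n => ->.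
  rewrite mulmxDr mulmxDl -!scalemxAr -!scalemxAl !mulmxA.
  by rewrite mxE mxE [in X in _ + X]mxE /x /y !mulmxA.
have t0 : 0 <= t%:num by [].
have t1 : 0 <= (1 - t%:num) by rewrite subr_ge0.
(* [x i] and [y i] may be negative; monotonicity first replaces them by absolute values, which lie
   in the half-line where [h] is convex. *)
have hs i : h (s 0 i) <= t%:num * h `|x i| + (1 - t%:num) * h `|y i|.
  apply: (@le_trans _ _ (h (t%:num * `|x i| + (1 - t%:num) * `|y i|))).
    apply: h_homo; rewrite ?in_itv/= ?andbT ?addr_ge0 ?mulr_ge0//.
    by rewrite sE lerD// ler_wpM2l// ler_norm.
  by apply: (h_convex t); rewrite inE/= in_itv/= normr_ge0.
apply: le_trans (ler_sum _ (fun i _ => hs i)) _.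
rewrite big_split/= -!mulr_sumr.
rewrite lerD// ler_wpM2l//; apply: sum_abs_diag_orthogonal => //.
all: by apply: orthogonal_mxM => //; exact: orthogonal_mx_tr.
Qed.

End ConvexSumOfSingularValues.

(** * The energy along a rank-one line *)

Lemma W_svd (R : realType) (psi : R -> R) (U V : 'M[R]_3) (s : 'rV[R]_3) :
  orthogonal_mx U -> orthogonal_mx V -> (forall i, 0 <= s 0 i) ->
  W psi (U *m diag_mx s *m V^T) = \sum_i psi `|ln (s 0 i)|.
Proof.
move=> oU oV s0; rewrite /W (perm_big _ (singular_values_svd oU oV s0))/=.
by rewrite big_map big_enum.
Qed.

(** [F^-T = U diag(1/s) V^T] shares its singular vectors with [F], so only the diagonal factors are
    added. *)
Lemma add_inv_tr_svd (R : realType) n (U V : 'M[R]_n) (s : 'rV[R]_n) :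
  orthogonal_mx U -> orthogonal_mx V -> (forall i, 0 < s 0 i) ->
  let F := U *m diag_mx s *m V^T in
  F + (invmx F)^T = U *m diag_mx (\row_i (s 0 i + (s 0 i)^-1)) *m V^T.
Proof.
move=> oU oV s0 F.
pose r := \row_i (s 0 i)^-1.
have sr : diag_mx s *m diag_mx r = 1%:M.
  rewrite mulmx_diag; apply/matrixP => i j; rewrite !mxE.
  by rewrite mulfV// gt_eqF.
have FG : F *m (V *m diag_mx r *m U^T) = 1%:M.
  rewrite /F !mulmxA -(mulmxA _ V^T V) oV mulmx1 -(mulmxA U) sr mulmx1.
  exact: mulmx1C oU.
have -> : invmx F = V *m diag_mx r *m U^T.
  have [uF _] := mulmx1_unit FG.
  by rewrite -[LHS]mulmx1 -FG mulKmx.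
rewrite !trmx_mul trmxK tr_diag_mx mulmxA -mulmxDl -mulmxDr -linearD/=.
by congr (_ *m diag_mx _ *m _); apply/rowP => i; rewrite !mxE.
Qed.

(** Sherman-Morrison with denominator [1 + t <b, F^-1 a> = 1]. Multiplying out leaves, besides the
    identity, a [t^2] term containing [T F^-1 T = a (b^T F^-1 a) b^T = 0] for [T = tensor a b]. *)
Lemma invmx_add_tensor (R : realType) n (F : 'M[R]_n) (a b : 'cV[R]_n) (t : R) :
  F \in unitmx -> dotv b (invmx F *m a) = 0 ->
  F + t *: tensor a b \in unitmx /\
  invmx (F + t *: tensor a b) =
    invmx F - t *: (invmx F *m tensor a b *m invmx F).
Proof.
move=> uF ab; set G := invmx F - _.
have bFa : b^T *m invmx F *m a = 0.
  apply/matrixP => i j; rewrite !ord1 [RHS]mxE -ab -mulmxA mxE.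
  by apply: eq_bigr => k _; rewrite mxE.
have TFT : tensor a b *m invmx F *m tensor a b = 0.
  by rewrite /tensor !mulmxA -2!(mulmxA a) bFa mulmx0 mul0mx.
have FG : (F + t *: tensor a b) *m G = 1%:M.
  rewrite {}/G; move: (tensor a b) TFT => T TFT.
  rewrite mulmxBr !mulmxDl -!scalemxAl -!scalemxAr !mulmxA TFT.
  by rewrite mulmxV// mul1mx mul0mx !scaler0 addr0 addrK.
have [uFt _] := mulmx1_unit FG.
by split => //; rewrite -[LHS]mulmx1 -FG mulKmx.
Qed.

Lemma two_le_add_inv (R : realFieldType) (x : R) : 0 < x -> 2 <= x + x^-1.
Proof.
move=> x0; rewrite -subr_ge0.
have -> : x + x^-1 - 2 = (x - 1) ^+ 2 / x by field; rewrite gt_eqF.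
by rewrite divr_ge0 ?sqr_ge0// ltW.
Qed.

Theorem proposition2p3 (R : realType) (psi g : R -> R)
    (gE : forall s : R, 2 <= s -> g s = psi (arcosh (s / 2)))
    (hg : exists gbar : R -> R,
      [/\ @convex_function R R^o `[0, +oo[ gbar,
          {in `[0, +oo[ &, {homo gbar : x y / x <= y}} &
          {in `[2, +oo[, gbar =1 g}])
    (F : 'M[R]_3) (a b : 'cV[R]_3)
    (hF : \det F = 1)
    (hab : dotv b (invmx F *m a) = 0) :
  @convex_function R R^o `[0, 1] (fun t : R => W psi (F + t *: tensor a b)).
Proof.
have [gbar [gbar_convex gbar_homo gbarE]] := hg.
have uF : F \in unitmx by rewrite unitmxE hF unitr1.
pose Ft t := F + t *: tensor a b; pose Gt t := Ft t + (invmx (Ft t))^T.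
have svd t : exists (U V : 'M[R]_3) (s : 'rV[R]_3),
    [/\ orthogonal_mx U, orthogonal_mx V, forall i, 0 <= s 0 i,
        Gt t = U *m diag_mx s *m V^T & W psi (Ft t) = \sum_i gbar (s 0 i)].
  have [uFt _] := invmx_add_tensor t uF hab.
  have [U [V [s [oU oV s0 FtE]]]] := invertible_mx_svd uFt.
  have s2 i : 2 <= s 0 i + (s 0 i)^-1 by exact: two_le_add_inv.
  exists U, V, (\row_i (s 0 i + (s 0 i)^-1)); split => //.
  - by move=> i; rewrite mxE (le_trans _ (s2 i)).
  - by rewrite /Gt /Ft FtE add_inv_tr_svd.
  - rewrite /Ft FtE W_svd//; last by move=> i; exact: ltW.
    (* As [s + 1/s >= 2], [gbar] agrees with [g] there, and [(s + 1/s) / 2 = cosh |ln s|] is undone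
       by [arcosh]. *)
    apply: eq_bigr => i _; rewrite mxE gbarE ?in_itv/= ?s2// gE//.
    by rewrite -cosh_norm_ln// arcoshK.
move=> t x y _ _ /=.
pose z := t%:num * x + (1 - t%:num) * y.
(* Both [Ft] and its inverse are affine in the parameter, and the weights sum to one. *)
have GtE : Gt z = t%:num *: Gt x + (1 - t%:num) *: Gt y.
  rewrite /Gt /Ft !(invmx_add_tensor _ uF hab).2.
  by apply/matrixP => i j; rewrite !mxE /z; ring.
have [U [V [s [oU oV s0 GE WE]]]] := svd z.
have [U0 [V0 [s0' [oU0 oV0 s00 GE0 WE0]]]] := svd x.
have [U1 [V1 [s1 [oU1 oV1 s10 GE1 WE1]]]] := svd y.
(* The abstract convex combinations of points and of values are converted to their arithmetic
   form. *)
rewrite -[W _ _]/(W psi (Ft z)).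
rewrite [leRHS]/(_ + _) -/(Ft x) -/(Ft y) WE WE0 WE1.
apply: (sum_singular_values_convex gbar_convex gbar_homo
  oU oV oU0 oV0 oU1 oV1) => //.
by rewrite -GE -GE0 -GE1.
Qed.
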